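(* Let $K$ be a discretely valued Henselian field, let $F(x)=a_d\prod_i(x-\alpha_i)\in K[x]$, with $\alpha_i\in\overline{K}$, be the polynomial defining a superelliptic curve $y^q=F(x)$ over $K$, and fix a cluster $\mathfrak{s}$ of roots of $F$. There exists $c_{\mathfrak{s}}\in\mathbb{Q}$ such that for all $x_0\in X_{\mathfrak{s}}$ and any $\alpha\in\mathfrak{s}$, $$v(F(x_0))=|\mathfrak{s}|\cdot v(x_0-\alpha)+c_{\mathfrak{s}},$$ where $c_{\mathfrak{s}}$ is given by $$c_{\mathfrak{s}}=v(a_d)+\sum_{\beta\in\mathfrak{s}^c}v(\alpha-\beta),$$ and all expressions above are independent of the choice of $\alpha\in\mathfrak{s}$.
   Context: $v$ is the valuation on $\overline{K}$ extending that of $K$, normalized so that $v(K^\times)=\mathbb{Z}$, with $v(0)=+\infty$; $|\cdot|$ is an associated absolute value. Here $q$ is a prime different from the residue characteristic of $K$, and $F$ is nonconstant and not divisible by the $q$-th power of a nonconstant polynomial. The roots $\{\alpha_i\}$ are listed with multiplicity; cardinalities of sets of roots and sums over sets of roots are taken with multiplicity. A cluster is a nonempty subset $\mathfrak{s}\subseteq\{\alpha_i\}$ of the form $\mathfrak{s}=D\cap\{\alpha_i\}$ with $D=\{x\in\overline{K}:|x-z|\le d\}$ for some $z\in\overline{K}$, $d\in\mathbb{R}$; $\mathfrak{s}^c$ is its complement in $\{\alpha_i\}$. For $x\in\overline{K}$ put $R_x=\min_i|x-\alpha_i|$, and let $X_{\mathfrak{s}}=\{x\in\overline{K}:|x-\alpha|=R_x\text{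 for all }\alpha\in\mathfrak{s},\ |x-\alpha'|>R_x\text{ for all }\alpha'\notin\mathfrak{s}\}$, where $\alpha'$ ranges over roots of $F$. *)

(* Defs.v *)
From mathcomp Require Import all_boot all_order all_algebra.
From mathcomp Require Import boolp constructive_ereal reals exp.

Set Implicit Arguments.
Unset Strict Implicit.
Unset Printing Implicit Defensive.

Import Order.TTheory GRing.Theory Num.Theory.

Local Open Scope ring_scope.
Local Open Scope ereal_scope.

(* Valuations take values in Q together with +oo. The type \bar rat also
   contains -oo, which valuation_neqNy excludes. *)
Record valuation (L : fieldType) (v : L -> \bar rat) : Prop := Valuation {
  valuation_neqNy : forall x, v x != -oo;
  valuation_eqy : forall x, (v x == +oo) = (x == 0%R);
  valuationM : forall x y, v (x * y)%R = v x + v y;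
  valuationD : forall x y, Order.min (v x) (v y) <= v (x + y)%R
}.

(* The value group v(K^x) is exactly Z. *)
Definition normalized_discrete (K : fieldType) (v : K -> \bar rat) : Prop :=
  (forall x : K, x != 0%R -> exists n : int, v x = (n%:~R)%:E) /\
  (forall n : int, exists2 x : K, x != 0%R & v x = (n%:~R)%:E).

(* Hensel's lemma for the ring 0 <= v with maximal ideal 0 < v: every simple
   root in the residue field of a monic integral polynomial lifts to a root. *)
Definition henselian (K : fieldType) (v : K -> \bar rat) : Prop :=
  forall (f : {poly K}) (a : K), f \is monic ->
    (forall i, 0 <= v f`_i) -> 0 <= v a ->
    0 < v f.[a] -> v (f^`()).[a] = 0 ->
  exists b : K, [/\ 0 <= v b, root f b & 0 < v (b - a)%R].

Record discrete_henselian (K : fieldType) (v : K -> \bar rat) : Prop :=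
  DiscreteHenselian {
    discrete_henselian_valuation : valuation v;
    discrete_henselian_discrete : normalized_discrete v;
    discrete_henselian_henselian : henselian v
  }.

(* p is the characteristic of the residue field: p%:R vanishes there when it
   lies in the maximal ideal. No p qualifies in residue characteristic 0. *)
Definition residue_char (K : fieldType) (v : K -> \bar rat) (p : nat) : Prop :=
  prime p /\ 0 < v p%:R%R.

Definition algebraic_closure (K : fieldType) (Kbar : closedFieldType)
    (iota : {rmorphism K -> Kbar}) : Prop :=
  forall x : Kbar, algebraicOver iota x.

(* The valuation w of Kbar extends the valuation v of K. *)
Definition extends_valuation (K L : fieldType) (iota : {rmorphism K -> L})
    (v : K -> \bar rat) (w : L -> \bar rat) : Prop :=
  valuation w /\ forall x : K, w (iota x) = v x.

(* |x| = b ^ (- v x) for some base b > 1, with |0| = 0. *)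
Definition associated_abs (R : realType) (L : fieldType) (v : L -> \bar rat)
    (abs : L -> R) : Prop :=
  exists2 b : R, (1 < b)%R &
    forall x, abs x = if v x is r%:E then (b `^ (- ratr r))%R else 0%R.

(* The conditions on F for y ^ q = F(x) to be a superelliptic curve over K. *)
Record superelliptic (K : fieldType) (v : K -> \bar rat) (q : nat)
    (F : {poly K}) : Prop := Superelliptic {
  superelliptic_prime : prime q;
  superelliptic_residue : ~ residue_char v q;
  superelliptic_nonconstant : (1 < size F)%N;
  superelliptic_power_free :
    forall g : {poly K}, (1 < size g)%N -> ~~ (g ^+ q %| F)%R
}.

Section Clusters.
Context {R : realType} {L : fieldType} {n : nat}.
(* The roots are listed with multiplicity as alpha 0, ..., alpha n, and sets of
   roots are sets of indices, so cardinals and sums count multiplicities. *)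
Variables (abs : L -> R) (alpha : 'I_n.+1 -> L).

Definition cluster (s : {set 'I_n.+1}) : Prop :=
  s != set0 /\
  exists (z : L) (d : R), s = [set i | (abs (alpha i - z) <= d)%R].

(* The term at ord0 is only there to give the iterated minimum a start value;
   it is one of the values being minimized. *)
Definition root_dist (x : L) : R :=
  \big[Num.min/abs (x - alpha ord0)]_(i < n.+1) abs (x - alpha i).

Definition in_X (s : {set 'I_n.+1}) (x : L) : Prop :=
  (forall i, i \in s -> abs (x - alpha i) = root_dist x) /\
  (forall j, j \notin s -> (root_dist x < abs (x - alpha j))%R).

End Clusters.

(* Main.v *)
(* The ultrametric inequality makes the root farther from x dominate: if
   v(x - b) < v(x - a) then v(a - b) = v(x - b). At a point x of X_s this turns
   each factor x - b, with b outside s, into alpha - b for any alpha in s; at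
   the centre of a disc cutting out s it shows that v(alpha - b) does not depend
   on alpha. *)
Require Import Defs.
From mathcomp Require Import all_boot all_order all_algebra.
From mathcomp Require Import boolp constructive_ereal reals exp.

Set Implicit Arguments.
Unset Strict Implicit.
Unset Printing Implicit Defensive.

Import Order.TTheory GRing.Theory Num.Theory.

Local Open Scope ring_scope.
Local Open Scope ereal_scope.

Lemma ler_powR_mono (R : realType) (b : R) : (1 < b)%R ->
  {mono powR b : x y / (x <= y)%R}.
Proof.
move=> b1 x y; rewrite /powR gt_eqF ?(lt_trans ltr01) //.
by rewrite ler_expR ler_pM2r // ln_gt0.
Qed.

Lemma sume_const (I : finType) (s : {set I}) (x : \bar rat) :
  \sum_(i in s) x = (#|s|%:R)%:E * x.
Proof. by rewrite sumr_const mule_natl. Qed.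

Section Valuation.
Context {L : fieldType} {v : L -> \bar rat}.
Hypothesis v_val : valuation v.

Lemma val_fin_num x : (v x \is a fin_num) = (x != 0%R).
Proof. by rewrite fin_numE (valuation_neqNy v_val) (valuation_eqy v_val). Qed.

Lemma val1 : v 1%R = 0.
Proof.
have: v 1%R \is a fin_num by rewrite val_fin_num oner_neq0.
have := valuationM v_val 1%R 1%R; rewrite mulr1.
by case: (v 1%R) => // r [/eqP]; rewrite -subr_eq subrr => /eqP <-.
Qed.

(** Squaring [-1] gives [2 v(-1) = v(1) = 0], and the rationals have no torsion. *)
Lemma valN x : v (- x)%R = v x.
Proof.
suff vN1 : v (-1)%R = 0 by rewrite -mulN1r (valuationM v_val) vN1 add0e.
have: v (-1)%R \is a fin_num by rewrite val_fin_num oppr_eq0 oner_neq0.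
have := valuationM v_val (-1)%R (-1)%R; rewrite mulrNN mulr1 val1.
case: (v (-1)%R) => // r [/esym/eqP]; rewrite -mulr2n mulrn_eq0 /= => /eqP ->.
by [].
Qed.

Lemma val_prod (I : finType) (P : pred I) (f : I -> L) :
  v (\prod_(i | P i) f i)%R = \sum_(i | P i) v (f i).
Proof. exact: (big_morph v (valuationM v_val) val1). Qed.

Lemma valD_lt x y : v x < v y -> v (x + y)%R = v x.
Proof.
move=> vxy; apply/eqP; rewrite eq_le; apply/andP; split; last first.
  by have := valuationD v_val x y; rewrite (min_idPl (ltW vxy)).
(* Writing [x = (x + y) - y] gives [min (v (x + y)) (v y) <= v x]. Since [v y] exceeds [v x], the
   minimum must be [v (x + y)]. *)
have := valuationD v_val (x + y)%R (- y)%R.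
by rewrite addrK valN ge_min [v y <= _]leNgt vxy orbF.
Qed.

Lemma valB_closer x a b : v (x - b)%R < v (x - a)%R ->
  v (a - b)%R = v (x - b)%R.
Proof.
move=> vab; rewrite -(subrKA x) addrC -(opprB x a) valD_lt //.
by rewrite valN.
Qed.

Lemma abs_le (R : realType) (abs : L -> R) : associated_abs v abs ->
  forall x y, (abs x <= abs y)%R = (v y <= v x).
Proof.
move=> [b b1 absE] x y; rewrite !absE.
have b0 : (0 < b)%R := lt_trans ltr01 b1.
have := valuation_neqNy v_val y; have := valuation_neqNy v_val x.
(* With [-oo] excluded, an infinite valuation means absolute value 0, which lies below every power
   of [b]. *)
case: (v x) => [r||] //; case: (v y) => [t||] // _ _.
- by rewrite lee_fin ler_powR_mono // lerN2 ler_rat.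
- by rewrite leNgt powR_gt0 // leNgt ltry.
- by rewrite powR_ge0 leey.
- by rewrite !lexx.
Qed.

Lemma abs_lt (R : realType) (abs : L -> R) : associated_abs v abs ->
  forall x y, (abs x < abs y)%R = (v y < v x).
Proof. by move=> vabs x y; rewrite !ltNge (abs_le vabs). Qed.

Lemma abs_eq (R : realType) (abs : L -> R) : associated_abs v abs ->
  forall x y, abs x = abs y -> v x = v y.
Proof. by move=> vabs x y xy; apply/le_anti; rewrite -!(abs_le vabs) xy lexx. Qed.

Section Roots.
Context {R : realType} {abs : L -> R} {n : nat} {alpha : 'I_n.+1 -> L}.
Context {s : {set 'I_n.+1}}.
Hypothesis vabs : associated_abs v abs.

(** The witness is the centre of a disc cutting out [s], whose radius separates the two kinds of
    roots. It need be neither a root nor a point of [X_s]. *)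
Lemma cluster_separated : cluster abs alpha s -> exists z, forall i j,
  i \in s -> j \notin s -> v (z - alpha j)%R < v (z - alpha i)%R.
Proof.
move=> [_ [z [d ->]]]; exists z => i j; rewrite !inE -ltNge => id dj.
by rewrite -!(valN (z - _)) !opprB -(abs_lt vabs) (le_lt_trans id).
Qed.

Lemma in_X_val_eq x i i' : in_X abs alpha s x -> i \in s -> i' \in s ->
  v (x - alpha i)%R = v (x - alpha i')%R.
Proof. by move=> [xs _] si si'; apply: (abs_eq vabs); rewrite !xs. Qed.

Lemma in_X_valB x i j : in_X abs alpha s x -> i \in s -> j \notin s ->
  v (alpha i - alpha j)%R = v (x - alpha j)%R.
Proof.
move=> [xs xsC] si sj; apply: valB_closer.
by rewrite -(abs_lt vabs) xs // xsC.
Qed.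

End Roots.
End Valuation.

Theorem lemma3p4 (R : realType) (K : fieldType) (Kbar : closedFieldType)
    (iota : {rmorphism K -> Kbar})
    (vK : K -> \bar rat) (v : Kbar -> \bar rat) (abs : Kbar -> R)
    (q n : nat) (F : {poly K}) (alpha : 'I_n.+1 -> Kbar) (s : {set 'I_n.+1}) :
  discrete_henselian vK ->
  algebraic_closure iota ->
  extends_valuation iota vK v ->
  associated_abs v abs ->
  superelliptic vK q F ->
  map_poly iota F =
    (iota (lead_coef F) *: \prod_(i < n.+1) ('X - (alpha i)%:P))%R ->
  cluster abs alpha s ->
  exists c : rat,
    [/\ forall (x0 : Kbar) (i : 'I_n.+1), in_X abs alpha s x0 -> i \in s ->
          v (map_poly iota F).[x0] = (#|s|%:R)%:E * v (x0 - alpha i)%R + c%:E,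
        forall i : 'I_n.+1, i \in s ->
          c%:E = v (iota (lead_coef F))
                 + \sum_(j in ~: s) v (alpha i - alpha j)%R,
        forall (x0 : Kbar) (i i' : 'I_n.+1), in_X abs alpha s x0 ->
          i \in s -> i' \in s -> v (x0 - alpha i)%R = v (x0 - alpha i')%R
      & forall i i' j : 'I_n.+1, i \in s -> i' \in s -> j \in ~: s ->
          v (alpha i - alpha j)%R = v (alpha i' - alpha j)%R].
Proof.
move=> _ _ [v_val _] vabs Fsuper Fprod s_cluster.
have [z zP] := cluster_separated v_val vabs s_cluster.
have [/set0Pn[i0 si0] _] := s_cluster.
have val_indep i j : i \in s -> j \notin s ->
    v (alpha i - alpha j)%R = v (z - alpha j)%R.
  by move=> si sj; exact: (valB_closer v_val (zP i j si sj)).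
(* The candidate constant is kept as a function of the base root, so that its independence of that
   root becomes the equation [cE]. *)
pose c i := v (iota (lead_coef F)) + \sum_(j in ~: s) v (alpha i - alpha j)%R.
have cE i : i \in s -> c i0 = c i.
  move=> si; congr (_ + _); apply: eq_bigr => j; rewrite inE => sj.
  by rewrite !val_indep.
(* Finiteness makes the constant a rational: [F] is nonzero because it is nonconstant, and no root
   outside [s] equals one in [s]. *)
have c_fin : c i0 \is a fin_num.
  rewrite fin_numD (val_fin_num v_val) fmorph_eq0 lead_coef_eq0 -size_poly_gt0.
  rewrite (ltnW (superelliptic_nonconstant Fsuper)) /=.
  apply/sum_fin_numP => j _; rewrite inE (val_fin_num v_val) subr_eq0 => sj.
  (* Equal roots would be equally far from [z], against the strict separation. *)
  by apply: contraTneq (zP _ _ si0 sj) => ->; rewrite ltxx.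
exists (fine (c i0)); rewrite fineK //; split.
- move=> x i xX si.
  rewrite Fprod hornerZ horner_prod (valuationM v_val) (val_prod v_val).
  (* The roots in [s] yield the multiple of [v (x - alpha i)], those outside [s] the sum in [c i].
     The computation stays in [\bar rat], so it also covers a root [x], where both sides are
     [+oo]. *)
  rewrite (bigID (mem s)) /= (cE _ si) addeCA; congr (_ + (_ + _)).
    rewrite -sume_const; apply: eq_bigr => j sj; rewrite hornerXsubC.
    exact: (in_X_val_eq v_val vabs xX sj si).
  apply: eq_big => [j|j sj]; first by rewrite inE.
  by rewrite hornerXsubC (in_X_valB v_val vabs xX si sj).
- by move=> i /cE.
- by move=> x i i'; exact: in_X_val_eq.
- by move=> i i' j si si'; rewrite inE => sj; rewrite !val_indep.
Qed.
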